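(* Let $s$ and $z$ be random signals on $\mathbb{S}^2$, both bandlimited to degree $L_f$, with spherical harmonic coefficients having finite second moments. Assume $z$ has zero mean, that $s$ and $z$ are uncorrelated, i.e. $\mathbb{E}\{(s)_n\overline{(z)_{n'}}\}=\mathbb{E}\{(z)_n\overline{(s)_{n'}}\}=0$ for all $n,n'$, and that the spectral covariance matrices $\mathbf{C}^s=(C^s_{nn'})$, $C^s_{nn'}=\mathbb{E}\{(s)_n\overline{(s)_{n'}}\}$, and $\mathbf{C}^z=(C^z_{nn'})$, $C^z_{nn'}=\mathbb{E}\{(z)_n\overline{(z)_{n'}}\}$, $0\le n,n'\le N_f$, are known. Let $f=s+z$. Consider the mean square error in the joint $SO(3)$-spectral domain $$\varepsilon=\mathbb{E}\Big\{\sum_{u=0}^{N_g}\big\|\nu(\cdot;u)-g_s(\cdot;u)\big\|_{SO(3)}^2\Big\},$$ viewed as a function of the filter coefficients $\big(\zeta(\cdot;u)\big)^p_{q,k}$, where $\nu$ is the filtered representation of $g_f$ defined in the context. For $0\le p\le L_h-1$, $|q|\le p$, $0\le u\le N_g$, let $\mathbf{F}(p,q,u)\in\mathbb{C}^{2p+1}$ have entries $F_k=\big(\zeta(\cdot;u)\big)^p_{q,k}$, $|k|\le p$. Let $\mathbf{A}(p,u)$ be the $(2p+1)\times(2p+1)$ matrix and $\mathbf{b}(p,q,u)\in\mathbb{C}^{2p+1}$ the vector with entries, for $|k|,|k'|\le p$, $$A_{k',k}=\sum_{n=0}^{N_f}\sum_{n'=0}^{N_f}T(n;p,k;u)\,\overline{T(n';p,k';u)}\,\big(C^s_{nn'}+C^z_{nn'}\big),$$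 $$b_{k'}=\sum_{n=0}^{N_f}\sum_{n'=0}^{N_f}T(n;p,q;u)\,\overline{T(n';p,k';u)}\,C^s_{nn'}.$$ Then the filter minimizing $\varepsilon$ is obtained by solving the linear systems $$\mathbf{A}(p,u)\,\mathbf{F}(p,q,u)=\mathbf{b}(p,q,u)\qquad\text{for all }0\le p\le L_h-1,\ |q|\le p,\ 0\le u\le N_g.$$ Precisely: every choice of filter coefficients satisfying all these systems minimizes $\varepsilon$; conversely, any minimizer satisfies the system for every $(p,q,u)$ with $\sum_{q'=-p}^{p}|(h)_p^{q'}|^2\neq 0$. (When a system is singular, a solution, e.g. via the Moore–Penrose pseudo-inverse, is used.)
   Context: Spherical harmonics $Y_\ell^m$ ($\ell\ge 0$, $|m|\le \ell$) form an orthonormal basis of $L^2(\mathbb{S}^2)$ with inner product $\langle f,h\rangle=\int_{\mathbb{S}^2}f(\hat x)\overline{h(\hat x)}\,ds(\hat x)$, $ds=\sin\theta\,d\theta\,d\phi$, and satisfy $\overline{Y_\ell^m}=(-1)^mY_\ell^{-m}$. Single index: $n=\ell(\ell+1)+m$, $Y_n=Y_\ell^m$, $(f)_n=(f)_\ell^m=\langle f,Y_\ell^m\rangle$. A signal is bandlimited to degree $L$ if $(f)_\ell^m=0$ for $\ell\ge L$, i.e. $(f)_n=0$ for $n\ge L^2$. $SO(3)$ is parametrized by Euler angles $\rho=(\varphi,\vartheta,\omega)$ (zyz convention), with measure $d\rho=d\varphi\,\sin\vartheta\,d\vartheta\,d\omega$, inner product $\langle g,\nu\rangle_{SO(3)}=\int_{SO(3)}g\bar\nu\,d\rho$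 and norm $\|g\|_{SO(3)}=\langle g,g\rangle_{SO(3)}^{1/2}$. The Wigner-$D$ functions $D^\ell_{m,m'}(\rho)$ satisfy $\int_{SO(3)}D^\ell_{m,m'}\overline{D^{\ell'}_{k,k'}}\,d\rho=\frac{8\pi^2}{2\ell+1}\delta_{\ell\ell'}\delta_{mk}\delta_{m'k'}$, and every $g\in L^2(SO(3))$ expands as $g=\sum_{\ell,m,m'}(g)^\ell_{m,m'}D^\ell_{m,m'}$ with $(g)^\ell_{m,m'}=\frac{2\ell+1}{8\pi^2}\langle g,D^\ell_{m,m'}\rangle_{SO(3)}$. The rotation operator $\mathcal{D}(\rho)$ on $L^2(\mathbb{S}^2)$ satisfies $\langle\mathcal{D}(\rho)h,Y_\ell^m\rangle=\sum_{m'=-\ell}^{\ell}D^\ell_{m,m'}(\rho)(h)_\ell^{m'}$. Spherical harmonic triple product: $T(n;p,q;u)=\int_{\mathbb{S}^2}Y_n(\hat x)Y_p^q(\hat x)\overline{Y_u(\hat x)}\,ds(\hat x)$. Fixed window $h\in L^2(\mathbb{S}^2)$ bandlimited to degree $L_h$. Set $L_g=L_f+L_h-1$, $N_f=L_f^2-1$, $N_g=L_g^2-1$. The DSLSHT of a signal $d$ bandlimited to $L_f$ is $g_d(\rho;u)=\int_{\mathbb{S}^2}d(\hat x)\,(\mathcal{D}(\rho)h)(\hat x)\,\overline{Y_u(\hat x)}\,ds(\hat x)$, $0\le u\le N_g$; its Wigner-$D$ coefficients in $\rho$ are $\big(g_d(\cdot;u)\big)^p_{q,q'}=\sum_{n=0}^{N_f}(d)_n(h)_p^{q'}T(n;p,q;u)$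 for $p\le L_h-1$ (and zero for $p\ge L_h$). Filter: for each $0\le u\le N_g$, a function $\zeta(\rho;u)=\sum_{p=0}^{L_h-1}\sum_{q,q'=-p}^{p}\big(\zeta(\cdot;u)\big)^p_{q,q'}D^p_{q,q'}(\rho)$. Filtered representation (SO(3) convolution of $g_f(\cdot;u)$ with $\zeta(\cdot;u)$): $$\nu(\rho;u)=\sum_{p=0}^{L_h-1}\sum_{q,q'=-p}^{p}\sum_{k=-p}^{p}\big(g_f(\cdot;u)\big)^p_{k,q'}\big(\zeta(\cdot;u)\big)^p_{q,k}D^p_{q,q'}(\rho).$$ *)

(* Defs.v *)
(* MathComp + MathComp-Analysis (R : realType), complex numbers R[i]
   from mathcomp-real-closed. *)
From mathcomp Require Import all_boot all_order all_algebra.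
From mathcomp Require Import all_classical all_reals all_analysis.
From mathcomp Require Import complex.
Set Implicit Arguments. Unset Strict Implicit. Unset Printing Implicit Defensive.
Import Order.TTheory GRing.Theory Num.Theory.
Local Open Scope classical_set_scope.
Local Open Scope ring_scope.
Local Open Scope complex_scope.

Section Defs.
Variable R : realType.
Local Notation C := R[i].

(* ---------- generic helpers ---------- *)

(* sum over q = -p, ..., p *)
Definition sumz (p : nat) (F : int -> C) : C :=
  \sum_(i < (2 * p).+1) F (i%:Z - p%:Z).

(* |x|^2 for a complex number, as a real *)
Definition csq (x : C) : R := (complex.Re x) ^+ 2 + (complex.Im x) ^+ 2.

(* e^{i t} *)
Definition expi (t : R) : C := cos t +i* sin t.

(* real Lebesgue integral over [a,b] *)
Definition intI (a b : R) (f : R -> R) : R :=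
  Rintegral (@lebesgue_measure R) `[a, b] f.

(* ---------- integrals on the sphere S^2 and on SO(3) ---------- *)

(* int_{S^2} F ds, ds = sin(theta) dtheta dphi, theta in [0,pi], phi in [0,2pi) *)
Definition cintS2 (F : R -> R -> C) : C :=
  (intI 0 (2 * pi) (fun phi => intI 0 pi (fun th => complex.Re (F th phi) * sin th)))
  +i*
  (intI 0 (2 * pi) (fun phi => intI 0 pi (fun th => complex.Im (F th phi) * sin th))).

(* Euler angles rho = (varphi, vartheta, omega) (zyz), d rho =
   d varphi sin(vartheta) d vartheta d omega *)
Definition cintSO3 (g : R * R * R -> C) : C :=
  (intI 0 (2 * pi) (fun ph => intI 0 pi (fun th => intI 0 (2 * pi)
     (fun om => complex.Re (g (ph, th, om)) * sin th))))
  +i*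
  (intI 0 (2 * pi) (fun ph => intI 0 pi (fun th => intI 0 (2 * pi)
     (fun om => complex.Im (g (ph, th, om)) * sin th)))).

(* ||g||_{SO(3)}^2 = int_{SO(3)} |g|^2 d rho (extended real, nonnegative) *)
Definition normSO3sq (g : R * R * R -> C) : \bar R :=
  (\int[@lebesgue_measure R]_(ph in `[0%R, (2 * pi)%R])
    \int[@lebesgue_measure R]_(th in `[0%R, pi])
      \int[@lebesgue_measure R]_(om in `[0%R, (2 * pi)%R])
         (csq (g (ph, th, om)) * sin th)%:E)%E.

(* ---------- spherical harmonics ---------- *)

(* associated Legendre function with Condon-Shortley phase, m >= 0:
   P_l^m(x) = (-1)^m (1-x^2)^{m/2} d^m/dx^m P_l(x),
   P_l(x) = 1/(2^l l!) d^l/dx^l (x^2-1)^l  (Rodrigues) *)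
Definition assocLegendre (l m : nat) (x : R) : R :=
  (-1) ^+ m * (Num.sqrt (1 - x ^+ 2)) ^+ m *
  (((('X ^+ 2 - 1) ^+ l : {poly R})^`(l + m)).[x]) / (2 ^+ l * (l`!)%:R).

(* Y_l^m(theta, phi) for m >= 0 *)
Definition Ypos (l m : nat) (th ph : R) : C :=
  (Num.sqrt ((2 * l + 1)%:R / (4 * pi) * ((l - m)`!)%:R / ((l + m)`!)%:R)
    * assocLegendre l m (cos th))%:C * expi (m%:R * ph).

(* Y_l^m for m : int, using conj(Y_l^m) = (-1)^m Y_l^{-m} *)
Definition Ylm (l : nat) (m : int) (th ph : R) : C :=
  match m with
  | Posz k => Ypos l k th ph
  | Negz k => (-1) ^+ k.+1 * (Ypos l k.+1 th ph)^*
  end.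

(* single index n = l(l+1) + m *)
Definition ell_of (n : nat) : nat := find (fun l => n < l.+1 ^ 2)%N (iota 0 n.+1).
Definition m_of (n : nat) : int := n%:Z - (ell_of n * (ell_of n).+1)%N%:Z.
Definition Yn (n : nat) (th ph : R) : C := Ylm (ell_of n) (m_of n) th ph.

(* triple product T(n; p, q; u) = int Y_n Y_p^q conj(Y_u) ds *)
Definition Ttriple (n p : nat) (q : int) (u : nat) : C :=
  cintS2 (fun th ph => Yn n th ph * Ylm p q th ph * (Yn u th ph)^*).

(* ---------- random variables ---------- *)

(* expectation of a complex random variable *)
Definition cE (d : measure_display) (Om : measurableType d)
    (P : probability Om R) (X : Om -> C) : C :=
  (Rintegral P setT (fun w => complex.Re (X w))) +i* (Rintegral P setT (fun w => complex.Im (X w))).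

(* ---------- DSLSHT and filtering ---------- *)

(* Wigner-D coefficients of g_d(.;u) for a signal with coefficients dc:
   (g_d(.;u))^p_{q,q'} = sum_{n=0}^{Nf} (d)_n (h)_p^{q'} T(n;p,q;u) *)
Definition gcoef (Nf : nat) (hc : nat -> int -> C) (dc : nat -> C)
    (p : nat) (q q' : int) (u : nat) : C :=
  \sum_(n < Nf.+1) dc n * hc p q' * Ttriple n p q u.

(* g_d(rho; u) = sum_{p < Lh} sum_{q,q'} (g_d)^p_{q,q'} D^p_{q,q'}(rho) *)
Definition gfun (Nf Lh : nat) (hc : nat -> int -> C)
    (D : nat -> int -> int -> R * R * R -> C) (dc : nat -> C)
    (u : nat) (rho : R * R * R) : C :=
  \sum_(p < Lh) sumz p (fun q => sumz p (fun q' =>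
     gcoef Nf hc dc p q q' u * D p q q' rho)).

(* filter zeta: zeta u p q k = (zeta(.;u))^p_{q,k} *)
Definition filt := nat -> nat -> int -> int -> C.

(* nu(rho;u) = sum_p sum_{q,q'} sum_k (g_f)^p_{k,q'} (zeta)^p_{q,k} D^p_{q,q'}(rho) *)
Definition nufun (Nf Lh : nat) (hc : nat -> int -> C)
    (D : nat -> int -> int -> R * R * R -> C) (fc : nat -> C) (zeta : filt)
    (u : nat) (rho : R * R * R) : C :=
  \sum_(p < Lh) sumz p (fun q => sumz p (fun q' =>
     sumz p (fun k => gcoef Nf hc fc p k q' u * zeta u p q k) * D p q q' rho)).

(* mean square error
   eps = E{ sum_{u=0}^{Ng} || nu(.;u) - g_s(.;u) ||^2_{SO(3)} } *)
Definition mse (d : measure_display) (Om : measurableType d)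
    (P : probability Om R) (Nf Ng Lh : nat) (hc : nat -> int -> C)
    (D : nat -> int -> int -> R * R * R -> C) (s z : nat -> Om -> C)
    (zeta : filt) : \bar R :=
  (\int[P]_w \sum_(u < Ng.+1)
     normSO3sq (fun rho =>
        (nufun Nf Lh hc D (fun n => s n w + z n w) zeta u rho
         - gfun Nf Lh hc D (fun n => s n w) u rho)%R))%E.

(* spectral covariances *)
Definition covC (d : measure_display) (Om : measurableType d)
    (P : probability Om R) (x y : nat -> Om -> C) (n n' : nat) : C :=
  cE P (fun w => x n w * (y n' w)^*).

(* A(p,u)_{k',k} *)
Definition Amat (Nf : nat) (Cs Cz : nat -> nat -> C) (p u : nat) (k' k : int) : C :=
  \sum_(n < Nf.+1) \sum_(n' < Nf.+1)
    Ttriple n p k u * (Ttriple n' p k' u)^* * (Cs n n' + Cz n n').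

(* b(p,q,u)_{k'} *)
Definition bvec (Nf : nat) (Cs : nat -> nat -> C) (p : nat) (q : int) (u : nat)
    (k' : int) : C :=
  \sum_(n < Nf.+1) \sum_(n' < Nf.+1)
    Ttriple n p q u * (Ttriple n' p k' u)^* * Cs n n'.

(* A(p,u) F(p,q,u) = b(p,q,u), with F_k = (zeta(.;u))^p_{q,k} *)
Definition system_holds (Nf : nat) (Cs Cz : nat -> nat -> C) (zeta : filt)
    (p : nat) (q : int) (u : nat) : Prop :=
  forall k' : int, (- p%:Z <= k' <= p%:Z)%R ->
    sumz p (fun k => Amat Nf Cs Cz p u k' k * zeta u p q k) = bvec Nf Cs p q u k'.

End Defs.

(* Main.v *)
Require Import Defs.
From mathcomp Require Import all_boot all_order all_algebra.
From mathcomp Require Import all_classical all_reals all_analysis.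
From mathcomp Require Import complex.
From mathcomp Require Import measurable_realfun zify ring lra.
Import Order.TTheory GRing.Theory Num.Theory.
Import numFieldNormedType.Exports.
Local Open Scope classical_set_scope.
Local Open Scope ring_scope.
Local Open Scope complex_scope.
Set Implicit Arguments. Unset Strict Implicit. Unset Printing Implicit Defensive.

(* By the orthogonality of the Wigner functions, the error splits as a sum over
   (u, p, q) of nonnegative multiples of E|sum_k a_k F_k - b|^2, where
   a_k = sum_n T(n;p,k;u) (f)_n and b = sum_n T(n;p,q;u) (s)_n: the factors
   (h)_p^q' come out of both coefficients and only contribute the weight
   8 pi^2 / (2p + 1) * sum_q' |(h)_p^q'|^2. Each summand involves its own
   unknowns F and is a least squares problem in L^2(P) whose normal equations
   are A(p,u) F = b(p,q,u), since s and z are uncorrelated. *)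

(** * Integration over SO(3) *)

Section IteratedIntegral.
Variable R : realType.
Local Notation mu := (@lebesgue_measure R).

Lemma integrable_continuous_itv (a b : R) (f : R -> R) :
  continuous f -> mu.-integrable `[a, b] (EFin \o f).
Proof.
move=> cf; apply: continuous_compact_integrable; first exact: segment_compact.
exact: continuous_subspaceT.
Qed.

Lemma EFin_intI (a b : R) (f : R -> R) : continuous f ->
  (\int[mu]_(x in `[a, b]) (f x)%:E)%E = (intI a b f)%:E.
Proof.
move=> cf; rewrite /intI /Rintegral fineK//.
by apply: integrable_fin_num => //; exact: integrable_continuous_itv.
Qed.

Lemma intI_lin (a b c : R) (f g : R -> R) : continuous f -> continuous g ->
  intI a b (fun x => c * f x + g x) = c * intI a b f + intI a b g.
Proof.
move=> cf cg; have icf : continuous (fun x => c * f x).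
  by move=> x; apply: cvgM; [exact: cvg_cst|exact: cf].
rewrite /intI RintegralD ?RintegralZl//; exact: integrable_continuous_itv.
Qed.

Lemma continuous_pairr (T U : topologicalType) (t : T) :
  continuous (fun y : U => (t, y)).
Proof. by move=> y; apply: cvg_pair; [exact: cvg_cst|exact: cvg_id]. Qed.

(* Compactness of [a, b] makes f(t', -) converge uniformly to f(t, -). *)
Lemma continuous_intI (T : topologicalType) (a b : R) (f : T * R -> R) :
  continuous f -> continuous (fun t => intI a b (fun y => f (t, y))).
Proof.
move=> cf t; have cft t' : continuous (fun y => f (t', y)).
  move=> y; apply: (@continuous_comp _ _ _ (fun y => (t', y)) f).
    exact: continuous_pairr.
  exact: cf.
apply/cvgrPdist_le => e e0 /=.
pose M := fine (mu `[a, b]).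
have M0 : 0 <= M by rewrite fine_ge0.
(* A pointwise bound by [e'] integrates to at most [e' * M], which is below [e]; the added 1 keeps
   the quotient defined when the interval is null. *)
pose e' := e / (M + 1).
have e'0 : 0 < e' by rewrite divr_gt0// ltr_wpDl.
have near_e' : \forall t' \near t,
    `[a, b] `<=` (fun y2 => `|f (t, y2) - f (t', y2)| <= e').
  have /compact_near_coveringP K := @segment_compact R a b.
  apply: (K T (nbhs t) (fun t2 y => `|f (t, y) - f (t2, y)| <= e')
    (nbhs_filter t)) => x _.
  have e2 : 0 < e' / 2 by rewrite divr_gt0.
  have /cvgrPdist_le/(_ _ e2) [] := cf (t, x).
  move=> [U V] /= [Ut Vx] UV; exists (V, U) => //= -[y1 t1] /= [Vy Ut1].
  have h1 := UV (t1, y1) (conj Ut1 Vy).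
  have h2 := UV (t, y1) (conj (nbhs_singleton Ut) Vy).
  rewrite /= in h1 h2.
  (* Both values are compared with [f (t, x)], at a cost of [e' / 2] each. *)
  have -> : f (t, y1) - f (t1, y1) = (f (t, x) - f (t1, y1)) - (f (t, x) - f (t, y1)).
    by ring.
  rewrite (le_trans (ler_normB _ _))// (splitr e') lerD//.
near=> t2.
have h : `[a, b] `<=` (fun y => `|f (t, y) - f (t2, y)| <= e') by near: t2.
have ci : continuous (fun y => f (t, y) - f (t2, y)).
  by move=> y; apply: cvgB; exact: cft.
rewrite /intI -RintegralB//; try exact: integrable_continuous_itv.
apply: (le_trans (le_normr_Rintegral _ _)) => //.
  exact: integrable_continuous_itv.
apply: (@le_trans _ _ (\int[mu]_(y in `[a, b]) e')).
  apply: le_Rintegral => //.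
  - apply: integrable_continuous_itv => y.
    by apply: cvg_norm; exact: ci.
  - by apply: integrable_continuous_itv => y; exact: cvg_cst.
rewrite Rintegral_cst//= -/M /e' mulrAC ler_pdivrMr ?ltr_wpDl//.
by rewrite ler_wpM2l ?(ltW e0)// lerDl.
Unshelve. all: by end_near.
Qed.

Definition intSO3 (f : R * R * R -> R) : R :=
  intI 0 (2 * pi) (fun ph => intI 0 pi (fun th => intI 0 (2 * pi)
     (fun om => f (ph, th, om) * sin th))).

Section Slices.
Variable f : R * R * R -> R.
Hypothesis cf : continuous f.

(** The density sin is absorbed into the integrand, so that [continuous_intI], applied first to [g]
    and then to [G2], gives the continuity needed to integrate one variable at a time. *)
Let g (x : R * R * R) := f x * sin x.1.2.

Let cg : continuous g.
Proof.
move=> x; apply: cvgM; first exact: cf.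
apply: (@continuous_comp _ _ _ (fun x : R * R * R => x.1.2) sin).
  apply: (@continuous_comp _ _ _ (fun x : R * R * R => x.1) snd).
    exact: cvg_fst.
  exact: cvg_snd.
exact: continuous_sin.
Qed.

Lemma continuous_slice1 ph th : continuous (fun om => f (ph, th, om) * sin th).
Proof.
move=> om; apply: (@continuous_comp _ _ _ (fun om => (ph, th, om)) g).
  exact: continuous_pairr.
exact: cg.
Qed.

Let G2 (x : R * R) := intI 0 (2 * pi) (fun om => f (x, om) * sin x.2).

Let cG2 : continuous G2.
Proof. exact: (@continuous_intI _ _ _ g). Qed.

Lemma continuous_slice2 ph :
  continuous (fun th => intI 0 (2 * pi) (fun om => f (ph, th, om) * sin th)).
Proof.
move=> th; apply: (@continuous_comp _ _ _ (fun th => (ph, th)) G2).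
  exact: continuous_pairr.
exact: cG2.
Qed.

Lemma continuous_slice3 :
  continuous (fun ph => intI 0 pi (fun th => intI 0 (2 * pi)
    (fun om => f (ph, th, om) * sin th))).
Proof. exact: (@continuous_intI _ _ _ G2). Qed.

End Slices.

Lemma intSO3_lin (c : R) (f g : R * R * R -> R) : continuous f -> continuous g ->
  intSO3 (fun x => c * f x + g x) = c * intSO3 f + intSO3 g.
Proof.
move=> cf cg; rewrite /intSO3 -intI_lin; try exact: continuous_slice3.
congr intI; apply/funext => ph.
rewrite -intI_lin; try exact: continuous_slice2.
congr intI; apply/funext => th.
rewrite -intI_lin; try exact: continuous_slice1.
by congr intI; apply/funext => om; rewrite mulrDl mulrA.
Qed.

(** Each partial integral is continuous on a compact interval, hence integrable with a finite value,
    so the extended real integrals become real ones from the outermost inwards. *)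
Lemma normSO3sqE (g : R * R * R -> R[i]) : continuous (fun x => csq (g x)) ->
  normSO3sq g = (intSO3 (fun x => csq (g x)))%:E.
Proof.
move=> cg; rewrite /normSO3sq /intSO3 -EFin_intI; last exact: (continuous_slice3 cg).
apply: eq_integral => ph _; rewrite -EFin_intI; last exact: (continuous_slice2 cg).
apply: eq_integral => th _; rewrite -EFin_intI//; exact: (continuous_slice1 cg).
Qed.

End IteratedIntegral.

(** * Hermitian forms and least squares *)

Section Csq.
Variable R : realType.
Implicit Types x y : R[i].

Lemma csq_ge0 x : 0 <= csq x.
Proof. by rewrite addr_ge0 ?sqr_ge0. Qed.

Lemma csqM x y : csq (x * y) = csq x * csq y.
Proof. by case: x y => [a b] [c e]; rewrite /csq /=; ring. Qed.

Lemma mul_conjc x : x * x^* = (csq x)%:C.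
Proof.
case: x => a b; rewrite /csq; apply/eqP; rewrite eq_complex /=.
by apply/andP; split; apply/eqP; ring.
Qed.

Lemma csq_eq0 x : csq x = 0 -> x = 0.
Proof.
case: x => a b /eqP; rewrite /csq /= paddr_eq0 ?sqr_ge0// !sqrf_eq0.
by case/andP => /eqP -> /eqP ->.
Qed.

End Csq.

(** By conversion, [cintSO3] is [cI] of [intSO3] and [cE] is [cI] of the real expectation, so one
    theory of Hermitian forms covers both SO(3) and the probability space. *)
Definition cI (R : realType) (T : Type) (I : (T -> R) -> R) (F : T -> R[i]) :
  R[i] := I (fun x => complex.Re (F x)) +i* I (fun x => complex.Im (F x)).

(* [I] is an integral on the real functions in [K], and [H] plays the role of
   L^2: products of its members can be integrated. *)
Record prehilbert (R : realType) (T : Type) (K : (T -> R) -> Prop)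
    (I : (T -> R) -> R) (H : (T -> R[i]) -> Prop) : Prop := {
  prehilbert_K0 : K (fun=> 0);
  prehilbert_KP : forall c f g, K f -> K g -> K (fun x => c * f x + g x);
  prehilbert_IP : forall c f g, K f -> K g ->
    I (fun x => c * f x + g x) = c * I f + I g;
  prehilbert_H0 : H (fun=> 0);
  prehilbert_HP : forall c X Y, H X -> H Y -> H (fun x => c * X x + Y x);
  prehilbert_HM : forall X Y, H X -> H Y ->
    K (fun x => complex.Re (X x * (Y x)^*)) /\
    K (fun x => complex.Im (X x * (Y x)^*)) }.

Section SesquilinearForm.
Variables (R : realType) (T : Type).
Local Notation C := R[i].
Variables (K : (T -> R) -> Prop) (I : (T -> R) -> R) (H : (T -> C) -> Prop).
Hypothesis S : prehilbert K I H.

Let K0 : K (fun=> 0). Proof. by case: S. Qed.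

Let KP c f g : K f -> K g -> K (fun x => c * f x + g x).
Proof. by case: S => _ + _ _ _ _; apply. Qed.

Let IP c f g : K f -> K g -> I (fun x => c * f x + g x) = c * I f + I g.
Proof. by case: S => _ _ + _ _ _; apply. Qed.

Let H0 : H (fun=> 0). Proof. by case: S. Qed.

Let HP c X Y : H X -> H Y -> H (fun x => c * X x + Y x).
Proof. by case: S => _ _ _ _ + _; apply. Qed.

Let HM X Y : H X -> H Y ->
  K (fun x => complex.Re (X x * (Y x)^*)) /\ K (fun x => complex.Im (X x * (Y x)^*)).
Proof. by case: S => _ _ _ _ _; apply. Qed.

Definition ip (X Y : T -> C) : C := cI I (fun x => X x * (Y x)^*).
Definition nsq (X : T -> C) : R := I (fun x => csq (X x)).

Let I0 : I (fun=> 0) = 0.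
Proof.
have /eqP := IP 1 K0 K0; under eq_fun do rewrite mulr0 addr0.
by rewrite mul1r -subr_eq0 opprD addNKr oppr_eq0 => /eqP.
Qed.

Let IZ c f : K f -> I (fun x => c * f x) = c * I f.
Proof.
move=> Kf; have := IP c Kf K0; rewrite I0 addr0 => <-.
by congr I; apply/funext => x; rewrite addr0.
Qed.

Let ID f g : K f -> K g -> I (fun x => f x + g x) = I f + I g.
Proof.
move=> Kf Kg; have := IP 1 Kf Kg; rewrite mul1r => <-.
by congr I; apply/funext => x; rewrite mul1r.
Qed.

Let KZ c f : K f -> K (fun x => c * f x).
Proof.
move=> Kf; suff -> : (fun x => c * f x) = (fun x => c * f x + 0) by exact: KP.
by apply/funext => x; rewrite addr0.
Qed.

Lemma ipP c X Y Z : H X -> H Y -> H Z ->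
  ip (fun x => c * X x + Y x) Z = c * ip X Z + ip Y Z.
Proof.
move=> HX HY HZ.
have [rX iX] := HM HX HZ; have [rY iY] := HM HY HZ.
rewrite /ip /cI; apply/eqP; rewrite eq_complex; apply/andP.
case: c => a b; split; apply/eqP.
  rewrite /= -mulNr -!IZ// -!ID//; try exact: KZ.
    congr I; apply/funext => x; case: (X x) (Y x) (Z x) => [? ?] [? ?] [? ?] /=.
    by ring.
  by have := KP a rX (KZ (- b) iX).
rewrite /= -!IZ// -!ID//; try exact: KZ.
  congr I; apply/funext => x; case: (X x) (Y x) (Z x) => [? ?] [? ?] [? ?] /=.
  by ring.
by have := KP a iX (KZ b rX).
Qed.

Lemma ipC X Y : H X -> H Y -> ip Y X = (ip X Y)^*.
Proof.
move=> HX HY; have [rX iX] := HM HX HY.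
rewrite /ip /cI /=; congr Complex.
  congr I; apply/funext => x; case: (X x) (Y x) => [? ?] [? ?] /=; ring.
rewrite -mulN1r -IZ//.
congr I; apply/funext => x; case: (X x) (Y x) => [? ?] [? ?] /=; ring.
Qed.

Lemma ipxx X : ip X X = (nsq X)%:C.
Proof.
rewrite /ip /cI /nsq; congr Complex; last first.
  by rewrite -[RHS]I0; congr I; apply/funext => x; rewrite mul_conjc.
by congr I; apply/funext => x; rewrite mul_conjc.
Qed.

Lemma H_sum (J : Type) (r : seq J) (Q : pred J) (c : J -> C) (X : J -> T -> C) :
  (forall j, Q j -> H (X j)) -> H (fun x => \sum_(j <- r | Q j) c j * X j x).
Proof.
move=> HX; elim: r => [|j r IHr].
  by under eq_fun do rewrite big_nil.
under eq_fun do rewrite big_cons.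
by case: (boolP (Q j)) => // Qj; apply: HP => //; exact: HX.
Qed.

Lemma ip0l Z : H Z -> ip (fun=> 0) Z = 0.
Proof.
move=> HZ; have /eqP := ipP 1 H0 H0 HZ; under eq_fun do rewrite mulr0 addr0.
by rewrite mul1r -subr_eq0 opprD addNKr oppr_eq0 => /eqP.
Qed.

Lemma ip_suml (J : Type) (r : seq J) (Q : pred J) (c : J -> C) (X : J -> T -> C)
    Z : (forall j, Q j -> H (X j)) -> H Z ->
  ip (fun x => \sum_(j <- r | Q j) c j * X j x) Z =
  \sum_(j <- r | Q j) c j * ip (X j) Z.
Proof.
move=> HX HZ; elim: r => [|j r IHr].
  by rewrite big_nil; under eq_fun do rewrite big_nil; exact: ip0l.
rewrite big_cons; under eq_fun do rewrite big_cons.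
case: (boolP (Q j)) => // Qj; rewrite ipP ?IHr//; first exact: HX.
exact: H_sum.
Qed.

Lemma ip_sumr (J : Type) (r : seq J) (Q : pred J) (c : J -> C) (X : J -> T -> C)
    Z : (forall j, Q j -> H (X j)) -> H Z ->
  ip Z (fun x => \sum_(j <- r | Q j) c j * X j x) =
  \sum_(j <- r | Q j) (c j)^* * ip Z (X j).
Proof.
move=> HX HZ; rewrite ipC ?ip_suml//; last exact: H_sum.
rewrite rmorph_sum; apply: eq_bigr => j Qj; rewrite rmorphM.
by rewrite [ip Z _]ipC//; exact: HX.
Qed.

(** Parseval's identity: when both arguments are expanded, orthogonality leaves only the diagonal
    terms. *)
Lemma nsq_orthogonal (J : finType) (c : J -> C) (X : J -> T -> C) (w : J -> R) :
  (forall j, H (X j)) ->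
  (forall i j, ip (X i) (X j) = if i == j then (w i)%:C else 0) ->
  nsq (fun x => \sum_j c j * X j x) = \sum_j csq (c j) * w j.
Proof.
move=> HX orth; apply: complexI; rewrite -ipxx ip_suml//; last exact: H_sum.
rewrite rmorph_sum; apply: eq_bigr => i _ /=; rewrite ip_sumr//.
rewrite (bigD1 i)//= big1 ?addr0 => [|j ji]; last first.
  by rewrite orth eq_sym (negbTE ji) mulr0.
by rewrite orth eqxx mulrA mul_conjc rmorphM.
Qed.

Lemma nsqD X Y : H X -> H Y ->
  nsq (fun x => X x + Y x) = nsq X + nsq Y + 2 * complex.Re (ip X Y).
Proof.
move=> HX HY; have [rXY _] := HM HX HY.
have nsqK Z : H Z -> K (fun x => csq (Z x)).
  by move=> HZ; have [+ _] := HM HZ HZ; under eq_fun do rewrite mul_conjc.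
have KXY : K (fun x => csq (X x) + csq (Y x)).
  have := KP 1 (nsqK _ HX) (nsqK _ HY).
  by under [Z in K Z -> _]eq_fun do rewrite mul1r.
rewrite /nsq -(ID (nsqK _ HX) (nsqK _ HY)) [RHS]addrC /ip /cI /= -IP//.
congr I; apply/funext => x; rewrite /csq.
by case: (X x) (Y x) => [? ?] [? ?] /=; ring.
Qed.

Lemma nsqZ c X : H X -> nsq (fun x => c * X x) = csq c * nsq X.
Proof.
move=> HX; rewrite /nsq -IZ.
  by congr I; apply/funext => x; rewrite csqM.
by have [+ _] := HM HX HX; under eq_fun do rewrite mul_conjc.
Qed.

Section LeastSquares.
Hypothesis nsq_ge0 : forall X, H X -> 0 <= nsq X.
Variables (J : finType) (a : J -> T -> C) (b : T -> C).
Hypothesis Ha : forall j, H (a j).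
Hypothesis Hb : H b.

Definition residual (v : J -> C) (x : T) : C := \sum_j a j x * v j - b x.

Let residualE v : residual v = fun x => -1 * b x + \sum_j v j * a j x.
Proof.
apply/funext => x; rewrite /residual mulN1r addrC.
by congr (_ + _); apply: eq_bigr => j _; rewrite mulrC.
Qed.

Lemma H_residual v : H (residual v).
Proof. by rewrite residualE; apply: HP => //; exact: H_sum. Qed.

(** Orthogonality of the residual to [a j] is thus the normal equation of index [j], and this inner
    product measures its defect. *)
Lemma ip_residual v j :
  ip (residual v) (a j) = \sum_i ip (a i) (a j) * v i - ip b (a j).
Proof.
rewrite residualE ipP ?ip_suml ?mulN1r 1?addrC//; last exact: H_sum.
by congr (_ - _); apply: eq_bigr => i _; rewrite mulrC.
Qed.

(** Exact expansion of the quadratic error at [v]: the linear part pairs the increment with the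
    defects of the normal equations. Both directions of the least squares criterion rest on it. *)
Lemma nsq_residualB v v' : nsq (residual v') = nsq (residual v) +
  nsq (fun x => \sum_j (v' j - v j) * a j x) +
  2 * complex.Re (\sum_j (v' j - v j)^* * ip (residual v) (a j)).
Proof.
rewrite -ip_sumr//; last exact: H_residual.
rewrite -nsqD; [|exact: H_residual|exact: H_sum].
congr nsq; apply/funext => x; rewrite /residual addrAC -big_split.
by congr (_ - _); apply: eq_bigr => j _; rewrite /=; ring.
Qed.

(** At a solution the linear part of the expansion vanishes, and the quadratic part is
    nonnegative. *)
Lemma normal_equations_min v v' :
  (forall j, \sum_i ip (a i) (a j) * v i = ip b (a j)) ->
  nsq (residual v) <= nsq (residual v').
Proof.
move=> eqv; rewrite (nsq_residualB v v') big1 ?mulr0 ?addr0; last first.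
  by move=> j _; rewrite ip_residual eqv subrr mulr0.
by rewrite lerDl nsq_ge0//; exact: H_sum.
Qed.

Lemma min_normal_equations v :
  (forall v', nsq (residual v) <= nsq (residual v')) ->
  forall j, \sum_i ip (a i) (a j) * v i = ip b (a j).
Proof.
move=> minv j; apply/eqP; rewrite -subr_eq0 -ip_residual; apply/eqP.
set r := ip _ _; apply: csq_eq0.
pose M := nsq (a j); have M0 : 0 <= M by exact: nsq_ge0.
(* Moving [v j] by [- t r] changes the error by [- t |r|^2 (2 - t M)], so that
   this step size is a strict improvement unless [r = 0]. *)
pose t := (M + 1)^-1.
have t0 : 0 < t by rewrite invr_gt0 ltr_wpDl.
have tM : t * (M + 1) = 1 by rewrite mulVf// gt_eqF// ltr_wpDl.
pose v' i := if i == j then v i - t%:C * r else v i.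
have dv i : v' i - v i = if i == j then - (t%:C * r) else 0.
  by rewrite /v'; case: ifP => _; rewrite ?subrr//; ring.
have sum_dv (F : J -> C) : \sum_i (v' i - v i) * F i = - (t%:C * r) * F j.
  rewrite (bigD1 j)//= dv eqxx big1 ?addr0// => i ij.
  by rewrite dv (negbTE ij) mul0r.
have sum_dvJ (F : J -> C) :
    \sum_i (v' i - v i)^* * F i = (- (t%:C * r))^* * F j.
  rewrite (bigD1 j)//= dv eqxx big1 ?addr0// => i ij.
  by rewrite dv (negbTE ij) rmorph0 mul0r.
have := minv v'; rewrite (nsq_residualB v v') sum_dvJ -/r.
under [X in _ <= _ + nsq X + _]eq_fun do rewrite sum_dv.
rewrite nsqZ// -/r -/M.
have -> : csq (- (t%:C * r)) = t ^+ 2 * csq r.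
  by case: (r) => x y; rewrite /csq /=; ring.
have -> : complex.Re ((- (t%:C * r))^* * r) = - (t * csq r).
  by case: (r) => x y; rewrite /csq /=; ring.
rewrite -addrA lerDl.
have -> : t ^+ 2 * csq r * M + 2 * - (t * csq r) =
    - (t * csq r * (2 - t * M)) by ring.
rewrite oppr_ge0 => h; have r0 := csq_ge0 r; apply/eqP; rewrite eq_le r0 andbT.
(* From [t * (M + 1) = 1], the factor [2 - t * M] equals [1 + t]. *)
have tp : 0 < t * (2 - t * M).
  by rewrite mulr_gt0//; rewrite mulrDr mulr1 in tM; nra.
by move: h; rewrite -mulrA mulrCA pmulr_lle0.
Qed.

End LeastSquares.
End SesquilinearForm.

(** * Square-integrable and continuous complex functions *)

Section SquareIntegrable.
Context (R : realType) (d : measure_display) (Om : measurableType d).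
Variable P : probability Om R.
Local Notation C := R[i].

Definition rintegrable (f : Om -> R) : Prop :=
  P.-integrable setT (EFin \o f).

Definition L2 (f : Om -> R) : Prop :=
  measurable_fun setT f /\ rintegrable (fun w => f w ^+ 2).

Definition cL2 (X : Om -> C) : Prop :=
  L2 (fun w => complex.Re (X w)) /\ L2 (fun w => complex.Im (X w)).

Lemma rintegrable0 : rintegrable (fun=> 0).
Proof. exact: integrable0. Qed.

Lemma rintegrableP c f g : rintegrable f -> rintegrable g ->
  rintegrable (fun w => c * f w + g w).
Proof.
move=> If Ig; have := integrableD measurableT (integrableZl measurableT c If) Ig.
by apply: eq_integrable.
Qed.

Lemma Rintegral_lin c f g : rintegrable f -> rintegrable g ->
  Rintegral P setT (fun w => c * f w + g w) =
  c * Rintegral P setT f + Rintegral P setT g.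
Proof.
move=> If Ig; rewrite RintegralD ?RintegralZl//.
by have := rintegrableP c If rintegrable0; apply: eq_integrable => // w _ /=; rewrite addr0.
Qed.

(** The product is dominated by [f ^+ 2 + g ^+ 2], because the square of |f| - |g| is
    nonnegative. *)
Lemma L2_mul f g : L2 f -> L2 g -> rintegrable (fun w => f w * g w).
Proof.
move=> [mf If] [mg Ig].
apply: (le_integrable _ _ _ (rintegrableP 1 If Ig)) => //.
  by apply/measurable_EFinP; exact: measurable_funM.
move=> w _; rewrite /= lee_fin mul1r [leRHS]ger0_norm ?addr_ge0 ?sqr_ge0//.
have := sqr_ge0 (`|f w| - `|g w|); rewrite sqrrB !real_normK ?num_real//.
rewrite normrM; have := normr_ge0 (f w); have := normr_ge0 (g w); nra.
Qed.

Lemma L2_0 : L2 (fun=> 0).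
Proof.
split; first exact: measurable_cst.
by have := rintegrable0; apply: eq_integrable => // w _ /=; rewrite expr0n.
Qed.

Lemma L2P c f g : L2 f -> L2 g -> L2 (fun w => c * f w + g w).
Proof.
move=> L2f L2g; have [mf If] := L2f; have [mg Ig] := L2g; split.
  by apply: measurable_funD => //; apply: measurable_funM.
have := rintegrableP (2 * c) (L2_mul L2f L2g) (rintegrableP (c ^+ 2) If Ig).
by apply: eq_integrable => // w _ /=; congr EFin; ring.
Qed.

Lemma cL2_0 : cL2 (fun=> 0).
Proof. by split; exact: L2_0. Qed.

Lemma cL2P c X Y : cL2 X -> cL2 Y -> cL2 (fun w => c * X w + Y w).
Proof.
move=> [rX iX] [rY iY]; case: c => a b; split.
  have := L2P a rX (L2P (- b) iX rY).
  by congr L2; apply/funext => w; case: (X w) (Y w) => [? ?] [? ?] /=; ring.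
have := L2P a iX (L2P b rX iY).
by congr L2; apply/funext => w; case: (X w) (Y w) => [? ?] [? ?] /=; ring.
Qed.

Lemma cL2_mul X Y : cL2 X -> cL2 Y ->
  rintegrable (fun w => complex.Re (X w * (Y w)^*)) /\
  rintegrable (fun w => complex.Im (X w * (Y w)^*)).
Proof.
move=> [rX iX] [rY iY]; split.
  have := rintegrableP 1 (L2_mul rX rY) (L2_mul iX iY).
  apply: eq_integrable => // w _ /=; congr EFin.
  by case: (X w) (Y w) => [? ?] [? ?] /=; ring.
have := rintegrableP (-1) (L2_mul rX iY) (L2_mul iX rY).
apply: eq_integrable => // w _ /=; congr EFin.
by case: (X w) (Y w) => [? ?] [? ?] /=; ring.
Qed.

Lemma cL2_prehilbert : prehilbert rintegrable (Rintegral P setT) cL2.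
Proof.
split; [exact: rintegrable0|exact: rintegrableP|exact: Rintegral_lin|
  exact: cL2_0|exact: cL2P|exact: cL2_mul].
Qed.

Lemma cL2_csq X : cL2 X -> rintegrable (fun w => csq (X w)).
Proof.
by move=> HX; have [+ _] := cL2_mul HX HX; under eq_fun do rewrite mul_conjc.
Qed.

Lemma nsq_Rintegral_ge0 X : 0 <= nsq (Rintegral P setT) X.
Proof. by apply: Rintegral_ge0 => w _; exact: csq_ge0. Qed.

End SquareIntegrable.

Section ContinuousComplex.
Variable (R : realType) (T : topologicalType).
Local Notation C := R[i].

Definition rcont (f : T -> R) : Prop := continuous f.

Definition ccont (X : T -> C) : Prop :=
  continuous (fun x => complex.Re (X x)) /\
  continuous (fun x => complex.Im (X x)).

Lemma rcont0 : rcont (fun=> 0).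
Proof. by move=> x; exact: cvg_cst. Qed.

Lemma rcont_mul f g : rcont f -> rcont g -> rcont (fun x => f x * g x).
Proof. by move=> cf cg x; apply: cvgM; [exact: cf|exact: cg]. Qed.

Lemma rcontP c f g : rcont f -> rcont g -> rcont (fun x => c * f x + g x).
Proof.
move=> cf cg x; apply: cvgD; last exact: cg.
by apply: cvgM; [exact: cvg_cst|exact: cf].
Qed.

Lemma ccont0 : ccont (fun=> 0).
Proof. by split; exact: rcont0. Qed.

Lemma ccontP c X Y : ccont X -> ccont Y -> ccont (fun x => c * X x + Y x).
Proof.
move=> [rX iX] [rY iY]; case: c => a b; split.
  have := rcontP (c:=a) rX (rcontP (c:=- b) iX rY).
  by congr rcont; apply/funext => w; case: (X w) (Y w) => [? ?] [? ?] /=; ring.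
have := rcontP (c:=a) iX (rcontP (c:=b) rX iY).
by congr rcont; apply/funext => w; case: (X w) (Y w) => [? ?] [? ?] /=; ring.
Qed.

Lemma ccont_mul X Y : ccont X -> ccont Y ->
  rcont (fun x => complex.Re (X x * (Y x)^*)) /\
  rcont (fun x => complex.Im (X x * (Y x)^*)).
Proof.
move=> [rX iX] [rY iY]; split.
  have := rcontP (c:=1) (rcont_mul rX rY) (rcont_mul iX iY).
  by congr rcont; apply/funext => w; case: (X w) (Y w) => [? ?] [? ?] /=; ring.
have := rcontP (c:=-1) (rcont_mul rX iY) (rcont_mul iX rY).
by congr rcont; apply/funext => w; case: (X w) (Y w) => [? ?] [? ?] /=; ring.
Qed.

End ContinuousComplex.

(** Continuous functions contain the Wigner functions and are stable under sums and products, and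
    the iterated integral is linear on them. *)
Lemma ccont_prehilbert (R : realType) :
  prehilbert (@rcont R _) (@intSO3 R) (@ccont R _).
Proof.
split; [exact: rcont0|exact: rcontP|exact: intSO3_lin|
  exact: ccont0|exact: ccontP|exact: ccont_mul].
Qed.

(** * Orders between -p and p as shifted ordinals *)

Lemma degree_range (p : nat) (i : 'I_(2 * p).+1) :
  - p%:Z <= i%:Z - p%:Z <= p%:Z.
Proof. have := ltn_ord i; lia. Qed.

Lemma degree_rangeP (p : nat) (q : int) : - p%:Z <= q <= p%:Z ->
  exists i : 'I_(2 * p).+1, q = i%:Z - p%:Z.
Proof.
move=> qp; have lt : (absz (q + p%:Z)%R < (2 * p).+1)%N by lia.
by exists (Ordinal lt) => /=; lia.
Qed.

Lemma degree_inj (p : nat) (i j : 'I_(2 * p).+1) :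
  i%:Z - p%:Z = j%:Z - p%:Z -> i = j.
Proof. move=> ij; apply: val_inj => /=; lia. Qed.

(** * Norms of finite Wigner expansions *)

Section WignerExpansion.
Variables (R : realType) (D : nat -> int -> int -> R * R * R -> R[i]).
Local Notation C := R[i].

Definition wigner_weight (l : nat) : R := (8 * pi ^+ 2) / (2 * l + 1)%:R.

Hypothesis cD : forall (l : nat) (m m' : int),
  continuous (fun rho : R * R * R => complex.Re (D l m m' rho)) /\
  continuous (fun rho : R * R * R => complex.Im (D l m m' rho)).
Hypothesis orthD : forall (l l' : nat) (m m' k k' : int),
  - l%:Z <= m <= l%:Z -> - l%:Z <= m' <= l%:Z ->
  - l'%:Z <= k <= l'%:Z -> - l'%:Z <= k' <= l'%:Z ->
  cintSO3 (fun rho => D l m m' rho * (D l' k k' rho)^*) =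
  (if [&& l == l', m == k & m' == k'] then (wigner_weight l)%:C else 0).

(** Parseval's identity for the Wigner functions, whose squared norms are the weights
    [wigner_weight]. *)
Lemma normSO3sq_wigner (L : nat) (c : nat -> int -> int -> C) :
  normSO3sq (fun rho => \sum_(p < L) sumz p (fun q => sumz p (fun q' =>
    c p q q' * D p q q' rho))) =
  (\sum_(p < L) \sum_(i < (2 * p).+1) \sum_(j < (2 * p).+1)
     csq (c p (i%:Z - p%:Z) (j%:Z - p%:Z)) * wigner_weight p)%:E.
Proof.
(* The ranges of the two orders depend on the degree, so a dependent pair type flattens the triple
   sum into a single orthogonal family. *)
pose J := {p : 'I_L & ('I_(2 * p).+1 * 'I_(2 * p).+1)%type}.
pose deg (t : J) : nat := tag t.
pose row (t : J) : int := (tagged t).1%:Z - (deg t)%:Z.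
pose col (t : J) : int := (tagged t).2%:Z - (deg t)%:Z.
pose X (t : J) := D (deg t) (row t) (col t).
pose cc (t : J) := c (deg t) (row t) (col t).
have sumJ (V : nmodType) (F : nat -> int -> int -> V) :
    \sum_(p < L) \sum_(i < (2 * p).+1) \sum_(j < (2 * p).+1)
      F p (i%:Z - p%:Z) (j%:Z - p%:Z) = \sum_t F (deg t) (row t) (col t).
  under eq_bigr do rewrite pair_big.
  by rewrite sig_big_dep.
have -> : (fun rho => \sum_(p < L) sumz p (fun q => sumz p (fun q' =>
    c p q q' * D p q q' rho))) = fun rho => \sum_t cc t * X t rho.
  by apply/funext => rho; rewrite -(sumJ _ (fun p q q' => c p q q' * D p q q' rho)).
have HX t : ccont (X t) by exact: cD.
have HS : ccont (fun rho => \sum_t cc t * X t rho).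
  exact: (H_sum (ccont_prehilbert R)).
rewrite normSO3sqE; last first.
  by have [+ _] := ccont_mul HS HS; under eq_fun do rewrite mul_conjc.
rewrite -/(nsq _ _).
rewrite (nsq_orthogonal (ccont_prehilbert R) _ (w := fun t => wigner_weight (deg t)))//.
  by rewrite -(sumJ _ (fun p q q' => csq (c p q q') * wigner_weight p)).
move=> t t'; rewrite [LHS]orthD; try exact: degree_range.
(* Equality of the degrees is settled first, since the types of the row and column indices depend on
   it. *)
congr (if _ then _ else _); apply/and3P/eqP => [|->]; last by [].
case: t t' => [p [i j]] [p' [i' j']]; rewrite /row /col /deg /=.
case=> /eqP pp /eqP + /eqP; have {}pp : p = p' by exact: val_inj.
by subst p' => /degree_inj -> /degree_inj ->.
Qed.

End WignerExpansion.

(** * The least squares problem of one block (u, p, q) *)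

Section FilterError.
Context (R : realType) (d : measure_display) (Om : measurableType d).
Variables (P : probability Om R) (Nf : nat) (hc : nat -> int -> R[i]).
Variables (s z : nat -> Om -> R[i]).
Local Notation C := R[i].
Local Notation cipP := (ip (Rintegral P setT)).

(** With [target], these are the coefficients of the transforms of f and s stripped of their factor
    (h)_p^q', as [gcoefE] shows. *)
Definition observed (p u : nat) (k : int) (w : Om) : C :=
  \sum_(n < Nf.+1) Ttriple R n p k u * (s n w + z n w).

Definition target (p u : nat) (q : int) (w : Om) : C :=
  \sum_(n < Nf.+1) Ttriple R n p q u * s n w.

Definition filter_residual (p u : nat) (q : int) (F : int -> C) : Om -> C :=
  residual (fun k : 'I_(2 * p).+1 => observed p u (k%:Z - p%:Z))
    (target p u q) (fun k => F (k%:Z - p%:Z)).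

Lemma gcoefE (dc : nat -> C) p q q' u : gcoef Nf hc dc p q q' u =
  hc p q' * \sum_(n < Nf.+1) Ttriple R n p q u * dc n.
Proof. by rewrite mulr_sumr; apply: eq_bigr => n _; ring. Qed.

(** The filter acts on the index [k], while h enters only through [q']; hence [hc p q'] is common to
    all terms and every [q'] has the same residual. *)
Lemma filtered_coefB (zeta : filt R) p u q q' w :
  sumz p (fun k => gcoef Nf hc (fun n => s n w + z n w) p k q' u * zeta u p q k)
    - gcoef Nf hc (fun n => s n w) p q q' u
  = hc p q' * filter_residual p u q (zeta u p q) w.
Proof.
rewrite gcoefE mulrBr; congr (_ - _); rewrite mulr_sumr.
by apply: eq_bigr => k _; rewrite gcoefE mulrA.
Qed.

Hypothesis L2s : forall n, (n <= Nf)%N -> cL2 P (s n).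
Hypothesis L2z : forall n, (n <= Nf)%N -> cL2 P (z n).

Let HS := cL2_prehilbert P.

Let L2f n : (n <= Nf)%N -> cL2 P (fun w => s n w + z n w).
Proof.
move=> nN; have := cL2P 1 (L2s nN) (L2z nN).
by congr cL2; apply/funext => w; rewrite mul1r.
Qed.

Lemma cL2_observed p u k : cL2 P (observed p u k).
Proof. by apply: (H_sum HS) => n _; apply: L2f; rewrite -ltnS. Qed.

Lemma cL2_target p u q : cL2 P (target p u q).
Proof. by apply: (H_sum HS) => n _; apply: L2s; rewrite -ltnS. Qed.

Lemma cL2_filter_residual p u q F : cL2 P (filter_residual p u q F).
Proof.
apply: (H_residual HS) => [k|]; [exact: cL2_observed|exact: cL2_target].
Qed.

Hypothesis uncorr : forall n n', (n <= Nf)%N -> (n' <= Nf)%N ->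
  covC P s z n n' = 0 /\ covC P z s n n' = 0.

Let ip_addl X Y Z : cL2 P X -> cL2 P Y -> cL2 P Z ->
  cipP (fun w => X w + Y w) Z = cipP X Z + cipP Y Z.
Proof.
move=> HX HY HZ; have := ipP HS 1 HX HY HZ; rewrite mul1r => <-.
by congr (cipP _ Z); apply/funext => w; rewrite mul1r.
Qed.

Let ip_addr X Y Z : cL2 P X -> cL2 P Y -> cL2 P Z ->
  cipP Z (fun w => X w + Y w) = cipP Z X + cipP Z Y.
Proof.
move=> HX HY HZ; have HXY : cL2 P (fun w => X w + Y w).
  have := cL2P 1 HX HY.
  by congr cL2; apply/funext => w; rewrite mul1r.
by rewrite (ipC HS HXY HZ) (ipC HS HX HZ) (ipC HS HY HZ) ip_addl// rmorphD.
Qed.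

(** The cross covariances of s and z vanish, so the Gram matrix of the observations is [Amat]. The
    indices appear swapped because the row index of [Amat] sits on the conjugated factor. *)
Lemma ip_observed p u k k' : cipP (observed p u k) (observed p u k') =
  Amat Nf (covC P s s) (covC P z z) p u k' k.
Proof.
have oN (n : 'I_Nf.+1) : (n <= Nf)%N by rewrite -ltnS.
rewrite (ip_suml HS); [|by move=> n _; exact: L2f|exact: cL2_observed].
apply: eq_bigr => n _; rewrite (ip_sumr HS) ?mulr_sumr;
  [|by move=> n' _; exact: L2f|exact: L2f].
apply: eq_bigr => n' _; rewrite mulrA; congr (_ * _).
have := oN n; have := oN n' => n'N nN.
rewrite ip_addr ?ip_addl//; try solve [exact: L2s|exact: L2z|exact: L2f].
have [sz zs] := uncorr nN n'N.
rewrite -[cipP (s n) (s n')]/(covC P s s n n') -[cipP (z n) (z n')]/(covC P z z n n').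
rewrite -[cipP (s n) (z n')]/(covC P s z n n') -[cipP (z n) (s n')]/(covC P z s n n').
by rewrite sz zs addr0 add0r.
Qed.

(** The noise enters only through its covariance with s, which is zero. *)
Lemma ip_target p u q k' :
  cipP (target p u q) (observed p u k') = bvec Nf (covC P s s) p q u k'.
Proof.
have oN (n : 'I_Nf.+1) : (n <= Nf)%N by rewrite -ltnS.
rewrite (ip_suml HS); [|by move=> n _; exact: L2s|exact: cL2_observed].
apply: eq_bigr => n _; rewrite (ip_sumr HS) ?mulr_sumr;
  [|by move=> n' _; exact: L2f|exact: L2s].
apply: eq_bigr => n' _; rewrite mulrA; congr (_ * _).
have := oN n; have := oN n' => n'N nN.
rewrite ip_addr; try solve [exact: L2s|exact: L2z].
rewrite -[cipP (s n) (s n')]/(covC P s s n n') -[cipP (s n) (z n')]/(covC P s z n n').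
by rewrite (uncorr nN n'N).1 addr0.
Qed.

Definition filter_error (p u : nat) (q : int) (F : int -> C) : R :=
  nsq (Rintegral P setT) (filter_residual p u q F).

Lemma system_holds_min (zeta : filt R) p q u :
  system_holds Nf (covC P s s) (covC P z z) zeta p q u ->
  forall F, filter_error p u q (zeta u p q) <= filter_error p u q F.
Proof.
move=> sys F; apply: (normal_equations_min HS).
- by move=> X _; exact: nsq_Rintegral_ge0.
- by move=> k; exact: cL2_observed.
- exact: cL2_target.
move=> k; rewrite ip_target -(sys _ (degree_range k)).
by apply: eq_bigr => k' _; rewrite ip_observed.
Qed.

Lemma min_system_holds (zeta : filt R) p q u :
  (forall F, filter_error p u q (zeta u p q) <= filter_error p u q F) ->
  system_holds Nf (covC P s s) (covC P z z) zeta p q u.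
Proof.
move=> minF k' /degree_rangeP[k ->]; rewrite -ip_target.
pose v (i : 'I_(2 * p).+1) := zeta u p q (i%:Z - p%:Z).
have obsL2 (i : 'I_(2 * p).+1) : cL2 P (observed p u (i%:Z - p%:Z)).
  exact: cL2_observed.
rewrite -(min_normal_equations HS _ obsL2 (cL2_target p u q) (v := v)).
- by apply: eq_bigr => i _; rewrite ip_observed.
- by move=> X _; exact: nsq_Rintegral_ge0.
(* A competitor indexed by ordinals is extended to all integers; only its values between -p and p
   affect the error. *)
move=> v'; pose F (q' : int) := v' (inord (absz (q' + p%:Z))).
suff -> : v' = fun i => F (i%:Z - p%:Z) by exact: minF.
by apply/funext => i; rewrite /F subrK absz_nat inord_val.
Qed.

(** * The mean square error as a weighted sum of block errors *)

Section MeanSquareError.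
Variables (Ng Lh : nat) (D : nat -> int -> int -> R * R * R -> C).
Hypothesis cD : forall (l : nat) (m m' : int),
  continuous (fun rho : R * R * R => complex.Re (D l m m' rho)) /\
  continuous (fun rho : R * R * R => complex.Im (D l m m' rho)).
Hypothesis orthD : forall (l l' : nat) (m m' k k' : int),
  - l%:Z <= m <= l%:Z -> - l%:Z <= m' <= l%:Z ->
  - l'%:Z <= k <= l'%:Z -> - l'%:Z <= k' <= l'%:Z ->
  cintSO3 (fun rho => D l m m' rho * (D l' k k' rho)^*) =
  (if [&& l == l', m == k & m' == k'] then (wigner_weight R l)%:C else 0).

(** As the residual does not depend on q', the sum over q' collapses into this factor, common to all
    orders q and all u. *)
Definition degree_weight (p : nat) : R :=
  wigner_weight R p * \sum_(j < (2 * p).+1) csq (hc p (j%:Z - p%:Z)).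

Lemma mseE (zeta : filt R) : mse P Nf Ng Lh hc D s z zeta =
  (\sum_(u < Ng.+1) \sum_(p < Lh) \sum_(i < (2 * p).+1) degree_weight p *
     filter_error p u (i%:Z - p%:Z) (zeta u p (i%:Z - p%:Z)))%:E.
Proof.
pose err u p (i : 'I_(2 * p).+1) w :=
  csq (filter_residual p u (i%:Z - p%:Z) (zeta u p (i%:Z - p%:Z)) w).
(* Integrability of each term lets the expectation pass through the three finite sums. *)
have interr u p i : P.-integrable setT (fun w => (degree_weight p * @err u p i w)%:E).
  have := cL2_csq (cL2_filter_residual p u (i%:Z - p%:Z) (zeta u p (i%:Z - p%:Z))).
  exact: integrableZl.
transitivity (\int[P]_w \sum_(u < Ng.+1) \sum_(p < Lh) \sum_(i < (2 * p).+1)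
    (degree_weight p * @err u p i w)%:E)%E.
  apply: eq_integral => w _; apply: eq_bigr => u _.
  (* For each outcome [w], these are the Wigner coefficients of the difference between the filtered
     representation and the transform of s. *)
  pose c p q q' := hc p q' * filter_residual p u q (zeta u p q) w.
  under eq_bigr do rewrite sumEFin.
  rewrite sumEFin.
  have := normSO3sq_wigner cD orthD Lh c.
  have -> : (fun rho => nufun Nf Lh hc D (fun n => s n w + z n w) zeta u rho -
      gfun Nf Lh hc D (fun n => s n w) u rho) =
    (fun rho => \sum_(p < Lh) sumz p (fun q => sumz p (fun q' =>
      c p q q' * D p q q' rho))).
    apply/funext => rho; rewrite /nufun /gfun /sumz -sumrB.
    apply: eq_bigr => p _; rewrite -sumrB; apply: eq_bigr => i _.
    rewrite -sumrB; apply: eq_bigr => j _.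
    by rewrite -mulrBl filtered_coefB.
  move=> ->; congr EFin; apply: eq_bigr => p _; apply: eq_bigr => i _.
  rewrite /degree_weight mulr_sumr mulr_suml; apply: eq_bigr => j _.
  by rewrite /c csqM /err; ring.
rewrite integral_sum//; last first.
  by move=> u; apply: integrable_sum => // p _; apply: integrable_sum.
rewrite -sumEFin; apply: eq_bigr => u _; rewrite integral_sum//; last first.
  by move=> p; apply: integrable_sum.
rewrite -sumEFin; apply: eq_bigr => p _; rewrite integral_sum//.
rewrite -sumEFin; apply: eq_bigr => i _.
rewrite -(fineK (integrable_fin_num measurableT (interr u p i))).
congr EFin; rewrite /filter_error /nsq -RintegralZl//.
exact: (cL2_csq (cL2_filter_residual _ _ _ _)).
Qed.

Lemma wigner_weight_gt0 l : 0 < wigner_weight R l.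
Proof. by rewrite divr_gt0 ?mulr_gt0 ?exprn_gt0 ?pi_gt0// ltr0n addn1. Qed.

Lemma degree_weight_ge0 p : 0 <= degree_weight p.
Proof.
rewrite mulr_ge0 ?(ltW (wigner_weight_gt0 _))//.
by apply: sumr_ge0 => j _; exact: csq_ge0.
Qed.

(** The Wigner weight is positive, so only the sum of the |h|^2 matters: a nonnegative real whose
    complex embedding is assumed nonzero. *)
Lemma degree_weight_gt0 p :
  sumz p (fun q' => (csq (hc p q'))%:C) != 0 -> 0 < degree_weight p.
Proof.
move=> hp; rewrite pmulr_rgt0 ?wigner_weight_gt0// lt_def.
rewrite sumr_ge0 ?andbT => [|j _]; last exact: csq_ge0.
by apply: contra hp => /eqP h0; rewrite /sumz -rmorph_sum /= h0.
Qed.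

(** In [mseE] each term has its own block of unknowns and a nonnegative weight, so minimizing every
    block minimizes the sum. *)
Lemma systems_min_mse (zeta : filt R) :
  (forall (p : nat) (q : int) (u : nat), (p < Lh)%N ->
     - p%:Z <= q <= p%:Z -> (u <= Ng)%N ->
     system_holds Nf (covC P s s) (covC P z z) zeta p q u) ->
  forall zeta' : filt R,
    (mse P Nf Ng Lh hc D s z zeta <= mse P Nf Ng Lh hc D s z zeta')%E.
Proof.
move=> sys zeta'; rewrite !mseE lee_fin.
apply: ler_sum => u _; apply: ler_sum => p _; apply: ler_sum => i _.
rewrite ler_wpM2l ?degree_weight_ge0// system_holds_min//.
apply: sys => //; [exact: degree_range|by rewrite -ltnS].
Qed.

(** Replacing one block of a minimizer leaves the other terms of [mseE] unchanged. They cancel, and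
    dividing by the positive weight shows that the block minimizes its own error. *)
Lemma min_mse_systems (zeta : filt R) :
  (forall zeta' : filt R,
     (mse P Nf Ng Lh hc D s z zeta <= mse P Nf Ng Lh hc D s z zeta')%E) ->
  forall (p : nat) (q : int) (u : nat), (p < Lh)%N ->
    - p%:Z <= q <= p%:Z -> (u <= Ng)%N ->
    sumz p (fun q' => (csq (hc p q'))%:C) != 0 ->
    system_holds Nf (covC P s s) (covC P z z) zeta p q u.
Proof.
move=> minz p q u pL qp uN hp; apply: min_system_holds => F.
have [i qE] := degree_rangeP qp.
pose zeta' : filt R := fun u' p' q' =>
  if [&& u' == u, p' == p & q' == q] then F else zeta u' p' q'.
(* Sums over the orders alone: they agree away from [(u, p)], which cancels the sums over [u] and
   [p] before the remaining orders are compared. *)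
pose T (x : filt R) u' p' : R := \sum_(i < (2 * p').+1)
  degree_weight p' * filter_error p' u' (i%:Z - p'%:Z) (x u' p' (i%:Z - p'%:Z)).
have T_neq u' p' : (u' != u) || (p' != p) -> T zeta' u' p' = T zeta u' p'.
  move=> neq; apply: eq_bigr => j _; rewrite /zeta' andbA -negb_and in neq *.
  by rewrite (negbTE neq).
have : T zeta u p <= T zeta' u p.
  have uN' : (u < Ng.+1)%N by [].
  have := minz zeta'; rewrite !mseE lee_fin -/(T zeta) -/(T zeta').
  rewrite (bigD1 (Ordinal uN')) ?[leRHS](bigD1 (Ordinal uN'))//.
  rewrite [X in _ <= _ + X -> _](eq_bigr (fun u' : 'I_Ng.+1 => \sum_(p < Lh) T zeta u' p)).
    rewrite lerD2r (bigD1 (Ordinal pL)) ?[leRHS](bigD1 (Ordinal pL))//.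
    rewrite [X in _ <= _ + X -> _](eq_bigr (fun p' : 'I_Lh => T zeta u p')).
      by rewrite lerD2r.
    by move=> p' neq; rewrite -T_neq// [p' != p :> nat]neq orbT.
  move=> u' neq; apply: eq_bigr => p' _.
  by rewrite -T_neq// [u' != u :> nat]neq.
rewrite /T (bigD1 i) ?[leRHS](bigD1 i)//=.
rewrite [X in _ <= _ + X -> _](eq_bigr (fun j : 'I_(2 * p).+1 =>
  degree_weight p * filter_error p u (j%:Z - p%:Z) (zeta u p (j%:Z - p%:Z)))).
  by rewrite lerD2r -qE /zeta' !eqxx ler_pM2l ?degree_weight_gt0.
move=> j neq; rewrite /zeta' (_ : (_ == q) = false) ?andbF//.
by apply: contraNF neq => /eqP; rewrite qE => /degree_inj ->.
Qed.

End MeanSquareError.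
End FilterError.

(** * Optimality of the joint SO(3)-spectral filter *)

Theorem theorem1
  (R : realType) (d : measure_display) (Om : measurableType d)
  (P : probability Om R)
  (Lf Lh : nat)
  (hc : nat -> int -> R[i])
  (D : nat -> int -> int -> R * R * R -> R[i])
  (s z : nat -> Om -> R[i]) :
  (0 < Lf)%N -> (0 < Lh)%N ->
  let Lg := (Lf + Lh).-1 in
  let Nf := (Lf ^ 2).-1 in
  let Ng := (Lg ^ 2).-1 in
  (* Wigner-D functions: continuous, with the orthogonality relation *)
  (forall (l : nat) (m m' : int),
      continuous (fun rho : R * R * R => complex.Re (D l m m' rho)) /\
      continuous (fun rho : R * R * R => complex.Im (D l m m' rho))) ->
  (forall (l l' : nat) (m m' k k' : int),
      - l%:Z <= m <= l%:Z -> - l%:Z <= m' <= l%:Z ->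
      - l'%:Z <= k <= l'%:Z -> - l'%:Z <= k' <= l'%:Z ->
      cintSO3 (fun rho => D l m m' rho * (D l' k k' rho)^*) =
      (if [&& l == l', m == k & m' == k']
       then ((8 * pi ^+ 2) / (2 * l + 1)%:R)%:C else 0)) ->
  (* coefficients of s, z are random variables with finite second moments *)
  (forall n, (n <= Nf)%N ->
     [/\ measurable_fun setT (fun w => complex.Re (s n w)),
         measurable_fun setT (fun w => complex.Im (s n w)),
         measurable_fun setT (fun w => complex.Re (z n w)) &
         measurable_fun setT (fun w => complex.Im (z n w))]) ->
  (forall n, (n <= Nf)%N ->
     [/\ P.-integrable setT (fun w => ((complex.Re (s n w)) ^+ 2)%:E),
         P.-integrable setT (fun w => ((complex.Im (s n w)) ^+ 2)%:E),
         P.-integrable setT (fun w => ((complex.Re (z n w)) ^+ 2)%:E) &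
         P.-integrable setT (fun w => ((complex.Im (z n w)) ^+ 2)%:E)]) ->
  (* z has zero mean *)
  (forall n, (n <= Nf)%N -> cE P (z n) = 0) ->
  (* s and z are uncorrelated *)
  (forall n n', (n <= Nf)%N -> (n' <= Nf)%N ->
     covC P s z n n' = 0 /\ covC P z s n n' = 0) ->
  let Cs := covC P s s in
  let Cz := covC P z z in
  let eps := mse P Nf Ng Lh hc D s z in
  (* every solution of all the linear systems minimizes eps *)
  (forall zeta : filt R,
     (forall (p : nat) (q : int) (u : nat), (p < Lh)%N ->
        - p%:Z <= q <= p%:Z -> (u <= Ng)%N ->
        system_holds Nf Cs Cz zeta p q u) ->
     forall zeta' : filt R, (eps zeta <= eps zeta')%E)
  /\
  (* every minimizer solves the system whenever sum_{q'} |h_p^{q'}|^2 <> 0 *)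
  (forall zeta : filt R,
     (forall zeta' : filt R, (eps zeta <= eps zeta')%E) ->
     forall (p : nat) (q : int) (u : nat), (p < Lh)%N ->
        - p%:Z <= q <= p%:Z -> (u <= Ng)%N ->
        sumz p (fun q' => (csq (hc p q'))%:C) != 0 ->
        system_holds Nf Cs Cz zeta p q u).
Proof.
move=> _ _ Lg Nf Ng cD orthD meas sqint _ uncorr Cs Cz eps.
have L2s n : (n <= Nf)%N -> cL2 P (s n).
  by move=> nN; have [? ? _ _] := meas n nN; have [? ? _ _] := sqint n nN.
have L2z n : (n <= Nf)%N -> cL2 P (z n).
  by move=> nN; have [_ _ ? ?] := meas n nN; have [_ _ ? ?] := sqint n nN.
split=> zeta.
  exact: (systems_min_mse hc L2s L2z uncorr cD orthD).
exact: (min_mse_systems L2s L2z uncorr cD orthD).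
Qed.
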